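(* For any hypercyclicity set $\mathscr{F}$ and any unbounded subset $\Gamma$ of $\mathbb{C}$, every unilateral pseudo-shift operator on $Z$ is $\mathscr{F}_{\Gamma}$-hypercyclic.
   Context: $\mathbb{N}=\{1,2,\dots\}$, $\mathbb{N}_0=\mathbb{N}\cup\{0\}$. $Z$ is either $c_0(\mathbb{N})$ or $\ell_p(\mathbb{N})$ for some $1\leq p<\infty$ (complex scalars), with canonical basis $\{e_n:n\geq1\}$. For a bounded sequence of positive numbers $\mathbf{w}=(w_n)_{n\geq1}$ and a strictly increasing function $\varphi:\mathbb{N}\to\mathbb{N}$ with $\varphi(1)>1$, the unilateral pseudo-shift operator $T_{\varphi,\mathbf{w}}$ on $Z$ is the bounded linear operator $T_{\varphi,\mathbf{w}}\left(\sum_{n=1}^\infty x_ne_n\right)=\sum_{n=1}^\infty w_{\varphi(n)}x_{\varphi(n)}e_n$. A Furstenberg family is a family $\mathscr{F}$ of subsets of $\mathbb{N}_0$ with $\emptyset\notin\mathscr{F}\neq\emptyset$ that is hereditarily upward: if $E\subset F\subset\mathbb{N}_0$ and $E\in\mathscr{F}$, then $F\in\mathscr{F}$. A hypercyclicity set is a Furstenberg family $\mathscr{F}$ for which there exists a sequence $(A_k)_{k\geq1}$ of pairwise disjoint sets in $\mathscr{F}$ such that for any $j\in A_k$ and $j'\in A_{k'}$ with $j\neq j'$ we have $|j-j'|\geq\max\{k,k'\}$. A bounded linear operator $T$ on $X$ is $\mathscr{F}_\Gamma$-hypercyclic if there is $x\in X$ such that $\{n\in\mathbb{N}_0: T^n(\Gamma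 x)\cap U\neq\emptyset\}\in\mathscr{F}$ for every non-empty open set $U\subset X$, where $\Gamma x=\{\lambda x:\lambda\in\Gamma\}$. *)

(* Defs.v *)
From HB Require Import structures.
From mathcomp Require Import all_boot all_order all_algebra.
From mathcomp Require Import complex.
From mathcomp Require Import all_classical all_reals all_analysis.

Set Implicit Arguments.
Unset Strict Implicit.
Unset Printing Implicit Defensive.

Import Order.TTheory GRing.Theory Num.Theory.
Import numFieldNormedType.Exports.
Import ComplexField.Normc.

Local Open Scope classical_set_scope.
Local Open Scope complex_scope.
Local Open Scope ring_scope.

Definition furstenberg_family (F : set (set nat)) : Prop :=
  [/\ ~ F set0, F !=set0 & forall E G, E `<=` G -> F E -> F G].

Definition hypercyclicity_set (F : set (set nat)) : Prop :=
  furstenberg_family F /\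
  exists A : nat -> set nat,
    [/\ forall k, (1 <= k)%N -> F (A k),
        trivIset [set k | (1 <= k)%N] A &
        forall k k' j j', (1 <= k)%N -> (1 <= k')%N -> A k j -> A k' j' ->
          j <> j' -> (maxn k k')%:Z <= `|j%:Z - j'%:Z| ].

Record bounded_operator (K : numFieldType) (X : normedModType K) :=
  BoundedOperator {
  operator :> {linear X -> X} ;
  operator_continuous : continuous operator
}.

Definition hypercyclic (K : numFieldType) (X : normedModType K)
    (F : set (set nat)) (Gamma : set K) (T : bounded_operator X) : Prop :=
  exists x : X, forall U : set X, open U -> U !=set0 ->
    F [set n | (iter n T @` [set l *: x | l in Gamma]) `&` U !=set0].

Variant space_kind (R : realType) := C0 | Ell (p : R) of 1 <= p.
Arguments C0 {R}.

Section sequence_space.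
Variable R : realType.
Local Notation C := R[i].
Implicit Types (Z : space_kind R) (x y : nat -> C^o).

Definition ell_norm (p : R) x : \bar R :=
  'N[counting]_p%:E[(fun n => (normc (x n))%:E)].

(* Index n stands for the positive integer n+1: [x n] is the coordinate on
   e_(n+1), and likewise for weights [w] and maps [phi] below, so that the
   condition phi(1) > 1 reads [(0 < phi 0)%N]. *)
Definition seq_mem Z x : Prop :=
  match Z with
  | C0 => x @ \oo --> (0 : C^o)
  | Ell p _ => (ell_norm p x < +oo)%E
  end.

Definition seq_norm Z x : R :=
  match Z with
  | C0 => sup (range (fun n => normc (x n)))
  | Ell p _ => fine (ell_norm p x)
  end.

Lemma normc_ge0 (z : C) : 0 <= normc z.
Proof. by case: z => a b; exact: sqrtr_ge0. Qed.

Lemma ell_norm_ge0 p x : (0 <= ell_norm p x)%E.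
Proof. exact: Lnorm_ge0. Qed.

Lemma ell_normE p x : 1 <= p -> ell_norm p x =
  ((\sum_(0 <= k <oo) ((normc (x k) `^ p)%:E)) `^ p^-1)%E.
Proof.
move=> p1; rewrite /ell_norm Lnorm_counting ?(lt_le_trans ltr01)//.
congr poweR; apply: eq_eseriesr => k _ /=.
by rewrite ger0_norm ?normc_ge0.
Qed.

Lemma ell_normD p x y : 1 <= p ->
  (ell_norm p (fun n => (x n + y n)%R) <= ell_norm p x + ell_norm p y)%E.
Proof.
move=> p1.
pose a n := normc (x n); pose b n := normc (y n).
apply: (@le_trans _ _ ('N[counting]_p%:E[EFin \o (a \+ b)%R])%E).
  have p0 : 0 <= p by apply: le_trans p1.
  rewrite /ell_norm !Lnorm_counting ?(lt_le_trans ltr01)//.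
  apply: gt0_ler_poweR; rewrite ?invr_ge0 //.
  - by rewrite in_itv/= leey andbT nneseries_ge0.
  - by rewrite in_itv/= leey andbT nneseries_ge0.
  apply: lee_nneseries => k _ /=; first by rewrite lee_fin powR_ge0.
  rewrite !ger0_norm ?addr_ge0 ?normc_ge0// lee_fin.
  by apply: ge0_ler_powR; rewrite ?nnegrE ?addr_ge0 ?normc_ge0// le_normcD.
exact: (@minkowski_EFin _ _ _ counting a b p).
Qed.

Lemma ell_norm_dom p (M : R) (phi : nat -> nat) x y : 1 <= p -> 0 <= M ->
  injective phi -> (forall n, normc (y n) <= M * normc (x (phi n))) ->
  (ell_norm p y <= M%:E * ell_norm p x)%E.
Proof.
move=> p1 M0 phiI le_yx; have p0 : 0 < p by exact: (lt_le_trans ltr01 p1).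
rewrite !ell_normE//.
have s0 u : (0 <= \sum_(0 <= k <oo) ((normc (u k : C) `^ p)%:E : \bar R))%E.
  by apply: nneseries_ge0 => k _ _; rewrite lee_fin powR_ge0.
have -> : (M%:E = (M `^ p)%:E `^ p^-1)%E.
  by rewrite poweR_EFin -powRrM mulfV ?gt_eqF// powRr1.
rewrite -poweRM ?lee_fin ?powR_ge0//.
apply: gt0_ler_poweR; rewrite ?invr_ge0 ?(ltW p0)//.
- by rewrite in_itv/= leey andbT s0.
- by rewrite in_itv/= leey andbT mule_ge0 ?lee_fin ?powR_ge0.
rewrite -nneseriesZl; last by move=> *; rewrite lee_fin powR_ge0.
apply: (@le_trans _ _ (\sum_(0 <= k <oo)
    ((M `^ p)%:E * (normc (x (phi k)) `^ p)%:E : \bar R))%E).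
  apply: lee_nneseries => k _; first by rewrite lee_fin powR_ge0.
  rewrite -EFinM lee_fin -powRM ?normc_ge0//.
  by apply: ge0_ler_powR; rewrite ?(ltW p0) ?nnegrE ?mulr_ge0 ?normc_ge0.
have h0 k : (0 <= (M `^ p)%:E * (normc (x k) `^ p)%:E)%E.
  by rewrite -EFinM lee_fin mulr_ge0 ?powR_ge0.
rewrite !nneseries_esumT//.
rewrite -(@esum_image _ _ _ setT phi
   (fun k => (M `^ p)%:E * (normc (x k) `^ p)%:E)%E); last exact: in2W.
rewrite esum_mkcond; apply: le_esum => k _.
by case: ifP.
Qed.

Lemma c0P x : x @ \oo --> (0 : C^o) <-> (normc (x n) @[n --> \oo] --> (0 : R)).
Proof.
split=> [/cvgrPdist_lt xC|/cvgrPdist_lt xR]; apply/cvgrPdist_lt => /= e e0.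
  have /xC : 0 < e%:C by rewrite ltcR.
  apply: filterS => n; rewrite !sub0r !normrN => h.
  by rewrite ger0_norm ?normc_ge0// -ltcR.
have eE : e = (complex.Re e)%:C by rewrite RRe_real// gtr0_real.
have /xR : 0 < complex.Re e by rewrite -ltcR -eE.
apply: filterS => n; rewrite !sub0r !normrN eE ger0_norm ?normc_ge0// => h.
by rewrite -[X in X < _]/((normc (x n))%:C) ltcR.
Qed.

Lemma c0_has_ubound x : x @ \oo --> (0 : C^o) ->
  has_ubound (range (fun n => normc (x n))).
Proof.
move=> /c0P h; apply/bounded_fun_has_ubound/cvg_seq_bounded.
by apply/cvg_ex; exists 0.
Qed.

Lemma c0_norm_ub x n : x @ \oo --> (0 : C^o) ->
  normc (x n) <= seq_norm C0 x.
Proof. by move=> /c0_has_ubound h; apply: ub_le_sup => //; exists n. Qed.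

Lemma c0_norm_le x (M : R) : (forall n, normc (x n) <= M) -> seq_norm C0 x <= M.
Proof.
move=> h; apply: ge_sup; first by exists (normc (x 0%N)); exists 0%N.
by move=> _ [n _ <-].
Qed.

Lemma seq_mem_dom Z (M : R) (phi : nat -> nat) x y : 0 <= M ->
  {homo phi : m n / (m < n)%N} ->
  (forall n, normc (y n) <= M * normc (x (phi n))) ->
  seq_mem Z x -> seq_mem Z y.
Proof.
move=> M0 phi_incr le_yx; have phiI : injective phi.
  move=> m n; case: (ltngtP m n) => // /phi_incr + e; by rewrite e ltnn.
case: Z => [|p p1] /=; last first.
  move=> xoo; apply: le_lt_trans (ell_norm_dom p1 M0 phiI le_yx) _.
  by rewrite lte_mul_pinfty ?lee_fin.
move=> /c0P xC; apply/c0P.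
have hx : M * normc (x n) @[n --> \oo] --> (0 : R).
  by rewrite -[X in _ --> X](mulr0 M); apply: cvgMl_tmp.
have le_phi n : (n <= phi n)%N.
  by elim: n => // n ih; apply: leq_ltn_trans ih (phi_incr _ _ _).
have hphi : phi n @[n --> \oo] --> \oo.
  move=> A [N _ NA]; exists N => // n /= Nn; apply: NA => /=.
  exact: leq_trans (le_phi n).
apply: (@squeeze_cvgr _ _ _ _ (cst 0) (fun n => M * normc (x (phi n)))).
- by near=> n; rewrite normc_ge0 le_yx.
- exact: cvg_cst.
- exact: (@cvg_comp _ _ _ phi (fun n => M * normc (x n)) _ _ _ hphi hx).
Unshelve. all: by end_near. Qed.

Definition seq_pred Z : {pred nat -> C^o} := mem [set x | seq_mem Z x].

Lemma seq_predP Z x : x \in seq_pred Z <-> seq_mem Z x.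
Proof. by rewrite inE. Qed.

Lemma seq_mem0 Z : seq_mem Z 0.
Proof.
case: Z => [|p p1] /=; first exact: cvg_cst.
have p0 : 0 < p by exact: (lt_le_trans ltr01 p1).
rewrite /ell_norm [X in Lnorm _ _ X](_ : _ = cst 0%E).
  by rewrite Lnorm0// eqe gt_eqF.
by apply/funext => n /=; congr EFin; exact: normc0.
Qed.

Lemma seq_memD Z x y : seq_mem Z x -> seq_mem Z y -> seq_mem Z (x + y).
Proof.
case: Z => [|p p1] /= hx hy; first by rewrite -(addr0 0); exact: cvgD.
by apply: le_lt_trans (ell_normD x y p1) _; exact: lte_add_pinfty.
Qed.

Lemma seq_memZ Z (a : C) x : seq_mem Z x -> seq_mem Z (a *: x).
Proof.
apply: (@seq_mem_dom Z (normc a) id); [exact: normc_ge0 | by [] |].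
by move=> n; rewrite -normcM.
Qed.

Lemma seq_submod_closed Z : submod_closed (seq_pred Z).
Proof.
split; first exact/seq_predP/seq_mem0.
move=> a x y /seq_predP hx /seq_predP hy.
by apply/seq_predP/seq_memD => //; exact: seq_memZ.
Qed.

HB.instance Definition _ Z := GRing.isSubmodClosed.Build _ _ (seq_pred Z)
  (seq_submod_closed Z).

Record seq_space Z := SeqSpace {
  seq_val :> nat -> C^o ;
  _ : seq_val \in seq_pred Z
}.

HB.instance Definition _ Z := [isSub for @seq_val Z].
HB.instance Definition _ Z := [Choice of seq_space Z by <:].
HB.instance Definition _ Z := [SubChoice_isSubLmodule of seq_space Z by <:].

Lemma seq_spaceP Z (x : seq_space Z) : seq_mem Z x.
Proof. exact/seq_predP/valP. Qed.

Lemma seq_spaceD Z (x y : seq_space Z) n : (x + y) n = x n + y n.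
Proof. by []. Qed.

Lemma seq_spaceZ Z (a : C) (x : seq_space Z) n : (a *: x) n = a * x n.
Proof. by []. Qed.

Lemma c0_norm_coord (x : seq_space C0) n : normc (x n) <= seq_norm C0 x.
Proof. exact/c0_norm_ub/(seq_spaceP x). Qed.

Lemma ell_norm_fin p p1 (x : seq_space (@Ell R p p1)) :
  ell_norm p x \is a fin_num.
Proof. by rewrite ge0_fin_numE ?ell_norm_ge0//; exact: (seq_spaceP x). Qed.

Lemma ell_seq_normE p p1 (x : seq_space (@Ell R p p1)) :
  (seq_norm (Ell p1) x)%:E = ell_norm p x.
Proof. by rewrite fineK// ell_norm_fin. Qed.

Lemma seq_norm_dom Z (M : R) (phi : nat -> nat) (x y : seq_space Z) : 0 <= M ->
  injective phi ->
  (forall n, normc (y n) <= M * normc (x (phi n))) ->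
  seq_norm Z y <= M * seq_norm Z x.
Proof.
move=> M0 phiI le_yx; case: Z => [|p p1] in x y le_yx *.
  apply: c0_norm_le => n; apply: le_trans (le_yx n) _.
  by apply: ler_wpM2l => //; exact: c0_norm_coord.
by rewrite -lee_fin EFinM !ell_seq_normE;
  exact: (ell_norm_dom p1 M0 phiI le_yx).
Qed.

Lemma seq_normD Z (x y : seq_space Z) :
  seq_norm Z (x + y : seq_space Z) <= seq_norm Z x + seq_norm Z y.
Proof.
case: Z => [|p p1] in x y *.
  apply: c0_norm_le => n; apply: le_trans (le_normcD _ _) _.
  by apply: lerD; exact: c0_norm_coord.
by rewrite -lee_fin EFinD !ell_seq_normE; exact: (ell_normD x y p1).
Qed.

Lemma normc_le_seq_norm Z (x : seq_space Z) n : normc (x n) <= seq_norm Z x.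
Proof.
case: Z x => [|p p1] x; first exact: c0_norm_coord.
have p0 : 0 < p by exact: (lt_le_trans ltr01 p1).
rewrite -lee_fin ell_seq_normE ell_normE//.
have -> : ((normc (x n))%:E = ((normc (x n)) `^ p)%:E `^ p^-1)%E.
  by rewrite poweR_EFin -powRrM mulfV ?gt_eqF// powRr1// normc_ge0.
have s0 k : (0 <= (normc (x k) `^ p)%:E)%E by rewrite lee_fin powR_ge0.
apply: gt0_ler_poweR; rewrite ?invr_ge0 ?(ltW p0)//.
- by rewrite in_itv/= leey andbT.
- by rewrite in_itv/= leey andbT nneseries_ge0.
rewrite nneseries_esumT//.
rewrite -[leLHS](@esum_set1 _ _ n (fun k => (normc (x k) `^ p)%:E))//.
by rewrite esum_mkcond; apply: le_esum => k _; case: ifP.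
Qed.

Lemma seq_norm_ge0 Z (x : seq_space Z) : 0 <= seq_norm Z x.
Proof. exact: le_trans (normc_ge0 _) (normc_le_seq_norm x 0%N). Qed.

Lemma seq_normZ Z (a : C) (x : seq_space Z) :
  seq_norm Z (a *: x : seq_space Z) = normc a * seq_norm Z x.
Proof.
apply/eqP; rewrite eq_le; apply/andP; split.
  apply: (@seq_norm_dom _ _ id); [exact: normc_ge0|exact: inj_id|].
  by move=> n; rewrite seq_spaceZ normcM.
have [->|a0] := eqVneq a 0; first by rewrite normc0 mul0r seq_norm_ge0.
have na0 : 0 < normc a.
  rewrite lt_neqAle normc_ge0 andbT eq_sym.
  by apply: contra a0 => /eqP/eq0_normc ->.
rewrite -ler_pdivlMl//.
apply: (@seq_norm_dom _ _ id); [by rewrite invr_ge0 normc_ge0|exact: inj_id|].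
by move=> n; rewrite seq_spaceZ normcM mulKf// gt_eqF.
Qed.

Lemma seq_norm_eq0 Z (x : seq_space Z) : seq_norm Z x = 0 -> x = 0.
Proof.
move=> x0; apply/val_inj/funext => n /=; apply: eq0_normc.
by apply/eqP; rewrite eq_le normc_ge0 andbT -x0 normc_le_seq_norm.
Qed.

Let seq_normC Z (x : seq_space Z) : C := (seq_norm Z x)%:C.

Let seq_normCD Z (x y : seq_space Z) :
  seq_normC (x + y) <= seq_normC x + seq_normC y.
Proof. by rewrite -rmorphD lecR seq_normD. Qed.

Let seq_normCZ Z (a : C) (x : seq_space Z) :
  seq_normC (a *: x) = `|a| * seq_normC x.
Proof. by rewrite /seq_normC seq_normZ rmorphM. Qed.

Let seq_normC_eq0 Z (x : seq_space Z) : seq_normC x = 0 -> x = 0.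
Proof. by move=> [] /seq_norm_eq0. Qed.

HB.instance Definition _ Z := Lmodule_isNormed.Build C (seq_space Z)
  (@seq_normCD Z) (@seq_normCZ Z) (@seq_normC_eq0 Z).

Lemma seq_normE Z (x : seq_space Z) : `|x| = (seq_norm Z x)%:C.
Proof. by []. Qed.

Section pseudo_shift.
Variables (Z : space_kind R) (w : nat -> R) (phi : nat -> nat).
Hypotheses (w_bounded : bounded_fun w) (phi_incr : {homo phi : m n / (m < n)%N}).

Definition pseudo_shift_seq x : nat -> C^o :=
  fun n => (w (phi n))%:C * x (phi n).

Let w_bound : {M : R | 0 <= M & forall n, `|w n| <= M}.
Proof.
apply/cid2; have [M M0 hM] := pinfty_ex_gt0 w_bounded.
by exists M; [exact: ltW | move=> n; exact: hM].
Qed.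

Let M := s2val w_bound.

Let le_pseudo_shift x n :
  normc (pseudo_shift_seq x n) <= M * normc (x (phi n)).
Proof.
rewrite normcM ler_wpM2r ?normc_ge0//.
rewrite /= expr0n/= addr0 sqrtr_sqr; exact: (s2valP' w_bound).
Qed.

Lemma pseudo_shift_subproof (x : seq_space Z) :
  pseudo_shift_seq x \in seq_pred Z.
Proof.
apply/seq_predP.
exact: (seq_mem_dom (s2valP w_bound) phi_incr (le_pseudo_shift x) (seq_spaceP x)).
Qed.

Definition pseudo_shift_fun (x : seq_space Z) : seq_space Z :=
  SeqSpace (pseudo_shift_subproof x).

Lemma pseudo_shift_is_linear : linear pseudo_shift_fun.
Proof.
move=> a x y; apply/val_inj/funext => n.
by rewrite /= /pseudo_shift_seq mulrDr mulrCA.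
Qed.

HB.instance Definition _ := GRing.isLinear.Build C (seq_space Z) (seq_space Z)
  _ pseudo_shift_fun pseudo_shift_is_linear.

Lemma pseudo_shift_continuous : continuous pseudo_shift_fun.
Proof.
apply: bounded_linear_continuous; apply/linear_boundedP.
exists M%:C; split; first by rewrite ger0_real// lecR; exact: (s2valP w_bound).
move=> r Mr x; apply: le_trans (_ : M%:C * `|x| <= _).
  rewrite !seq_normE -rmorphM lecR.
  apply: (seq_norm_dom (phi := phi)) => //; first exact: (s2valP w_bound).
    move=> m n; case: (ltngtP m n) => // /phi_incr + e; by rewrite e ltnn.
  exact: le_pseudo_shift.
by rewrite ler_wpM2r// ltW.
Qed.

Definition pseudo_shift : bounded_operator (seq_space Z) :=
  BoundedOperator pseudo_shift_continuous.

End pseudo_shift.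

End sequence_space.

(* Main.v *)
Require Import Defs.
From mathcomp Require Import all_boot all_order all_algebra.
From mathcomp Require Import complex.
From mathcomp Require Import all_classical all_reals all_analysis.
From mathcomp Require Import zify.

Import Order.TTheory GRing.Theory Num.Theory.
Import numFieldNormedType.Exports.

Local Open Scope classical_set_scope.
Local Open Scope complex_scope.
Local Open Scope ring_scope.

Import ComplexField.Normc.

(** Write T for the pseudo-shift.  Its iterates are weighted substitutions,
    (T^n x)_i = W_n(i) x_(phi^n i) with W_n(i) > 0 a product of weights, and
    phi^n i >= n + i, so T^n kills every vector supported in [0, n[.

    Enumerate the finitely supported vectors with rational coordinates as
    y_0, y_1, ..., each one occurring infinitely often and y_k supported in
    [0, k[.  At a time n in A_k, the orbit of l_n x has to be close to y_k, for
    some l_n in Gamma.  Asking for exact agreement on the first k coordinates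
    prescribes x at the positions phi^n a with a < k.  The gap condition on the
    sets A_k makes all these positions distinct: phi^n b = phi^m a with n < m
    gives b = phi^(m-n) a >= m - n, which is at least the block length at time
    n.  Hence x can be defined coordinate by coordinate, with
    x_(phi^n a) = y_k(a) / (l_n W_n(a)) and zero elsewhere, and no series has to
    be summed in the space ([extension_by_zero], [active_positions_inj]).

    The error of T^n (l_n x) - y_k only comes from later times m > n: earlier
    ones are killed by T^n, again by the gap condition.  A later time m
    contributes a coordinate proportional to l_n / l_m.  Since Gamma is
    unbounded, l_m can be chosen so large with respect to all the earlier l_n
    that its i-th coordinate is at most 2^-i / (m + 1) ([rapid_sequence],
    [ex_size_bound]).  Moreover m >= m - n >= k, so the i-th coordinate of the
    whole error is at most 2^-i / (k + 1) ([simultaneous_approximation]).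

    A vector dominated by M 2^-i has norm at most M B, where B is the norm of
    the geometric sequence ([seq_norm_le_geometric]).  The error is thus at most
    B / (k + 1) for every n in A_k.  By density of the rational vectors
    ([rational_vector_dense]), any open set contains a ball of radius greater
    than B / (k + 1) around some y_k, so the return times contain A_k and
    belong to the family. *)

(** * Coordinatewise estimates of the norm *)

Section coordinate_estimates.
Variable R : realType.
Implicit Types Z : space_kind R.

Lemma normc_real (r : R) : normc (r%:C) = `|r|.
Proof. by rewrite /= expr0n addr0 sqrtr_sqr. Qed.

Lemma half_exp_gt0 i : 0 < 2^-1 ^+ i :> R.
Proof. by rewrite exprn_gt0. Qed.

Lemma half_exp_le1 i : 2^-1 ^+ i <= 1 :> R.
Proof. by rewrite exprn_ile1 ?invr_ge0// invf_le1 ?ler1n. Qed.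

Lemma seq_mem_geometric Z : seq_mem Z (fun i => (2^-1 ^+ i : R)%:C).
Proof.
case: Z => [|p p1] /=.
  apply/c0P; under eq_fun do rewrite normc_real ger0_norm ?(ltW (half_exp_gt0 _))//.
  by apply: cvg_expr; rewrite ger0_norm ?invr_ge0// invf_lt1 ?ltr1n.
rewrite ell_normE//; apply: poweR_lty.
apply: (@le_lt_trans _ _ 2%:E); last exact: ltry.
have <- : (\sum_(0 <= k <oo) (2 / (2 ^ (k + 1))%:R : R)%:E = 2%:E)%E.
  have := @cvg_geometric_eseries_half R 2 0.
  by move=> /(cvg_lim (@ereal_hausdorff R)) ->; rewrite expr0 divr1.
apply: lee_nneseries => k _; first by rewrite lee_fin powR_ge0.
rewrite lee_fin normc_real ger0_norm ?(ltW (half_exp_gt0 _))//.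
rewrite addn1 expnS natrM invfM mulVKf// natrX -exprVn.
by apply: ge1r_powR => //; rewrite half_exp_gt0 half_exp_le1.
Qed.

Lemma seq_mem_le_geometric Z (M : R) (z : nat -> R[i]^o) : 0 <= M ->
  (forall i, normc (z i) <= M * 2^-1 ^+ i) -> seq_mem Z z.
Proof.
move=> M0 zM; apply: (@seq_mem_dom _ Z M id _ z M0 _ _ (seq_mem_geometric Z)) => //.
by move=> n; rewrite normc_real ger0_norm ?(ltW (half_exp_gt0 _)).
Qed.

(** This turns coordinatewise bounds into norm bounds uniformly over all the
    sequence spaces: the norm is monotone in the moduli of the coordinates. *)
Lemma seq_norm_le_geometric Z : exists2 B : R, 0 < B &
  forall (z : seq_space Z) (M : R), 0 <= M ->
    (forall i, normc (z i) <= M * 2^-1 ^+ i) -> seq_norm Z z <= M * B.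
Proof.
have gP : (fun i => (2^-1 ^+ i : R)%:C) \in seq_pred Z.
  exact/seq_predP/seq_mem_geometric.
have gE i : normc (SeqSpace gP i) = 2^-1 ^+ i.
  by rewrite normc_real ger0_norm ?(ltW (half_exp_gt0 _)).
exists (seq_norm Z (SeqSpace gP)).
  by apply: lt_le_trans (normc_le_seq_norm (SeqSpace gP) 0); rewrite gE expr0.
move=> z M M0 zM; apply: (seq_norm_dom (phi := id)) => // n.
by rewrite gE.
Qed.

Lemma seq_mem_finite_support Z N (z : nat -> R[i]^o) :
  (forall i, (N <= i)%N -> z i = 0) -> seq_mem Z z.
Proof.
move=> z0; pose t i : R := normc (z i) / 2^-1 ^+ i.
have t0 i : 0 <= t i by rewrite divr_ge0 ?normc_ge0 ?ltW ?half_exp_gt0.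
apply: (@seq_mem_le_geometric Z (\sum_(i < N) t i)).
  by apply: sumr_ge0 => i _.
move=> i; have [iN|Ni] := ltnP i N; last first.
  by rewrite z0// normc0 mulr_ge0 ?sumr_ge0// ltW ?half_exp_gt0.
rewrite -ler_pdivrMr ?half_exp_gt0//.
by rewrite (bigD1 (Ordinal iN))//= lerDl sumr_ge0.
Qed.

(** Density of the finitely supported vectors.  It is stated for any [z] that
    agrees with a tail of [x], which avoids a truncation operator. *)
Lemma seq_norm_tail Z (x : seq_space Z) (e : R) : 0 < e -> exists N,
  forall z : seq_space Z, (forall i, (i < N)%N -> z i = 0) ->
    (forall i, (N <= i)%N -> z i = x i) -> seq_norm Z z <= e.
Proof.
move=> e0; case: Z x => [|p p1] x.
  have /c0P/cvgrPdist_le/(_ e e0) [N _ xN] := seq_spaceP x.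
  exists N => z z0 zx; apply: c0_norm_le => i.
  have [iN|Ni] := ltnP i N; first by rewrite z0// normc0 ltW.
  rewrite zx//; have := xN i Ni.
  by rewrite /= sub0r normrN ger0_norm ?normc_ge0.
have p0 : 0 < p by exact: (lt_le_trans ltr01 p1).
have xoo : (\sum_(0 <= k <oo) (normc (x k) `^ p)%:E < +oo)%E.
  have := seq_spaceP x; rewrite /= ell_normE//; apply: lty_poweRy.
  by rewrite invr_eq0 gt_eqF.
have x0 k : (0 <= (normc (x k) `^ p)%:E)%E by rewrite lee_fin powR_ge0.
have /fine_cvgP[_ /cvgrPdist_le/(_ (e `^ p))] :=
  nneseries_tail_cvg xoo (fun k _ => x0 k).
case; first by rewrite powR_gt0.
move=> N _ xN; exists N => z z0 zx.
rewrite -lee_fin ell_seq_normE ell_normE//.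
have -> : (e%:E = (e `^ p)%:E `^ p^-1)%E.
  by rewrite poweR_EFin -powRrM mulfV ?gt_eqF// powRr1 ?ltW.
have zE : (\sum_(0 <= k <oo) (normc (z k) `^ p)%:E =
           \sum_(N <= k <oo) (normc (x k) `^ p)%:E)%E.
  rewrite (nneseries_split 0 N); last by move=> k _; rewrite lee_fin powR_ge0.
  rewrite add0n big_nat big1 ?add0e.
    by apply: congr_lim; apply/funext => n; rewrite big_nat [RHS]big_nat;
      apply: eq_bigr => k /andP[Nk _]; rewrite zx.
  by move=> k /andP[_ kN]; rewrite z0// normc0 powR0 ?gt_eqF.
have tail0 : (0 <= \sum_(N <= k <oo) (normc (x k) `^ p)%:E)%E.
  exact: nneseries_ge0.
apply: gt0_ler_poweR; rewrite ?invr_ge0 ?(ltW p0)// ?zE.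
- by rewrite in_itv/= leey andbT.
- by rewrite in_itv/= leey andbT lee_fin powR_ge0.
have tail_fin : (\sum_(N <= k <oo) (normc (x k) `^ p)%:E)%E \is a fin_num.
  rewrite ge0_fin_numE//; apply: le_lt_trans xoo.
  rewrite (nneseries_split 0 N)// add0n leeDr//.
  by apply: sume_ge0.
rewrite -(fineK tail_fin) lee_fin.
have := xN N (leqnn N); rewrite /= sub0r normrN ger0_norm//.
exact: fine_ge0.
Qed.

End coordinate_estimates.

(** * Density of the rational vectors *)

Section rational_vectors.
Variable R : realType.
Implicit Types Z : space_kind R.

Definition rational_vector (s : seq (rat * rat)) (i : nat) : R[i]^o :=
  ratr (nth (0, 0) s i).1 +i* ratr (nth (0, 0) s i).2.

Lemma rational_vector_default s i : (size s <= i)%N -> rational_vector s i = 0.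
Proof. by move=> si; rewrite /rational_vector nth_default//= rmorph0. Qed.

Lemma normc_le_ReIm (z : R[i]) : normc z <= `|complex.Re z| + `|complex.Im z|.
Proof.
case: z => a b /=; rewrite -ler_sqr ?nnegrE ?addr_ge0 ?sqrtr_ge0//.
rewrite sqr_sqrtr ?addr_ge0 ?sqr_ge0// sqrrD !real_normK ?num_real//.
by rewrite lerD2r lerDl mulrn_wge0// mulr_ge0.
Qed.

Lemma rational_approx (z : R[i]) (e : R) : 0 < e -> exists q : rat * rat,
  normc (z - (ratr q.1 +i* ratr q.2)) <= e.
Proof.
move=> e0; have e20 : 0 < e / 2 by rewrite divr_gt0.
have approx (a : R) : exists q : rat, `|a - ratr q| <= e / 2.
  have [|q] := @rat_in_itvoo R (a - e / 2) (a + e / 2).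
    by rewrite ltrD2l gtrN.
  by rewrite in_itv/= => /andP[q1 q2]; exists q; rewrite ler_distlC !ltW.
have [q1 q1P] := approx (complex.Re z); have [q2 q2P] := approx (complex.Im z).
exists (q1, q2); apply: le_trans (normc_le_ReIm _) _.
by case: z q1P q2P => a b /= q1P q2P; rewrite (splitr e) lerD.
Qed.

(** After truncation, the finitely many remaining coordinates are approximated
    with geometrically decreasing errors, so that [seq_norm_le_geometric]
    applies.  The vector [v] is quantified because [rational_vector s] is a
    bare sequence, without a membership proof. *)
Lemma rational_vector_dense Z (x : seq_space Z) (e : R) : 0 < e -> exists s,
  forall v : seq_space Z, v = rational_vector s :> (nat -> R[i]^o) ->
    seq_norm Z (x - v) <= e.
Proof.
move=> e0; have e20 : 0 < e / 2 by rewrite divr_gt0.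
have [N tailN] := @seq_norm_tail R Z x _ e20.
have [B B0 boundB] := seq_norm_le_geometric R Z.
have d0 i : 0 < e / 2 / B * 2^-1 ^+ i.
  by rewrite !mulr_gt0 ?invr_gt0 ?half_exp_gt0.
have [q qP] := choice (fun i => @rational_approx (x i) _ (d0 i)).
exists (mkseq q N) => v vE.
have vin i : (i < N)%N -> v i = ratr (q i).1 +i* ratr (q i).2.
  by move=> iN; rewrite vE /rational_vector nth_mkseq.
have vout i : (N <= i)%N -> v i = 0.
  by move=> Ni; rewrite vE rational_vector_default// size_mkseq.
have tP : (fun i => if (i < N)%N then 0 else x i) \in seq_pred Z.
  apply/seq_predP.
  apply: (@seq_mem_dom _ Z 1 id x _ _ _ _ (seq_spaceP x)) => // i.
  by rewrite mul1r; case: ifP => // _; rewrite normc0 normc_ge0.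
(* t is the tail of x, and x - v - t is supported in [0, N[. *)
pose t := SeqSpace tP.
have -> : x - v = t + (x - v - t) by rewrite [RHS]addrC subrK.
rewrite (splitr e); apply: le_trans (seq_normD _ _) _; apply: lerD.
  by apply: tailN => i iN /=; [rewrite iN|rewrite ltnNge iN].
have -> : e / 2 = e / 2 / B * B by rewrite divfK// gt_eqF.
apply: boundB => [|i]; first by rewrite divr_ge0 ?ltW.
have -> : (x - v - t) i = x i - v i - t i by [].
rewrite /=; case: ifPn => [iN|]; first by rewrite subr0 vin.
by rewrite -leqNgt => Ni; rewrite vout// subr0 subrr normc0 ltW.
Qed.

End rational_vectors.

(** * Rapidly growing scalars *)

(** Comparing [l m] with its predecessor only is enough, once the moduli are
    made nondecreasing. *)
Lemma rapid_sequence (R : realType) (Gamma : set R[i]) (K : nat -> R) :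
  ~ bounded_set (Gamma : set R[i]^o) ->
  exists l : nat -> R[i], [/\ forall m, Gamma (l m),
    forall m, 0 < normc (l m), forall m, K m <= normc (l m) &
    forall n m, (n < m)%N -> K m * normc (l n) <= normc (l m)].
Proof.
move=> unb.
have big (r : R) : exists z, Gamma z /\ r <= normc z.
  apply: contrapT => /forallNP nbig; apply: unb.
  exists r%:C; split; first by rewrite complex_real.
  move=> M rM z Gz; apply: le_trans (ltW rM).
  have /not_andP[//|/negP] := nbig z.
  by rewrite -ltNge => /ltW; rewrite -lecR.
have [g gP] := choice big.
(* The factor 1 + `|K m| >= 1 keeps the moduli nondecreasing, and the maximum
   with 1 keeps them positive. *)
pose next m r := g ((1 + `|K m|) * Order.max 1 r).
pose fix l m := if m is m'.+1 then next m (normc (l m')) else next 0%N 0.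
have ltK m : K m <= 1 + `|K m| by rewrite (le_trans (ler_norm _)) ?lerDr.
have K1 m : 1 <= 1 + `|K m| by rewrite lerDl.
have K0 m : 0 <= 1 + `|K m| by rewrite addr_ge0.
have nextP m r : [/\ 1 <= normc (next m r), r <= normc (next m r),
    K m <= normc (next m r) & (1 + `|K m|) * r <= normc (next m r)].
  have [_ nextr] := gP ((1 + `|K m|) * Order.max 1 r).
  have max1 : 1 <= Order.max 1 r by rewrite le_max lexx.
  have maxr : r <= Order.max 1 r by rewrite le_max lexx orbT.
  have maxm : Order.max 1 r <= normc (next m r).
    by apply: le_trans nextr; rewrite ler_peMl// (le_trans _ max1).
  split.
  - exact: le_trans maxm.
  - exact: le_trans maxm.
  - by apply: le_trans nextr; apply: le_trans (ltK m) _; rewrite ler_peMr.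
  - by apply: le_trans nextr; rewrite ler_wpM2l.
have l1 m : 1 <= normc (l m).
  by case: m => [|m]; [have [] := nextP 0%N 0|have [] := nextP m.+1 (normc (l m))].
have l_mono : {homo (fun m => normc (l m)) : m n / (m <= n)%N >-> m <= n}.
  apply: (@homo_leq _ (fun m => normc (l m)) (fun x y => x <= y)) => [//|y x z|m].
    exact: le_trans.
  by case: (nextP m.+1 (normc (l m))).
exists l; split=> [m|m|m|n [//|m]].
- by case: m => [|m]; exact: (gP _).1.
- exact: lt_le_trans (l1 m).
- by case: m => [|m]; [have [] := nextP 0%N 0|have [] := nextP m.+1 (normc (l m))].
rewrite ltnS => nm; have [_ _ _] := nextP m.+1 (normc (l m)).
apply: le_trans; apply: (@le_trans _ _ ((1 + `|K m.+1|) * normc (l n))).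
  by rewrite ler_wpM2r ?normc_ge0.
by rewrite ler_wpM2l ?l_mono.
Qed.

(** * Orbits of the pseudo-shift *)

Lemma extension_by_zero (T J : Type) (V : nmodType) (D : set T)
    (f : T -> J) (v : T -> V) : {in D &, injective f} ->
  exists x : J -> V, (forall p, D p -> x (f p) = v p) /\
    (forall j, (forall p, D p -> f p <> j) -> x j = 0).
Proof.
move=> f_inj.
exists (fun j => if pselect (exists p, D p /\ f p = j) is left h
                 then v (projT1 (cid h)) else 0); split=> [p Dp|j nj].
  case: pselect => [h|]; last by case; exists p.
  case: (cid h) => q [Dq fq] /=.
  by rewrite (f_inj q p)// inE.
by case: pselect => // -[p [Dp fp]]; case: (nj p Dp).
Qed.

Section pseudo_shift_orbits.
Variables (R : realType) (w : nat -> R) (phi : nat -> nat).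
Hypothesis w_gt0 : forall n, 0 < w n.
Hypothesis phi_incr : {homo phi : m n / (m < n)%N}.
Hypothesis phi_gt0 : (0 < phi 0)%N.

Definition orbit_weight n i : R := \prod_(j < n) w (iter j.+1 phi i).

Lemma orbit_weight_gt0 n i : 0 < orbit_weight n i.
Proof. by apply: prodr_gt0. Qed.

Lemma iter_pseudo_shift Z (wb : bounded_fun w) n (x : seq_space Z) i :
  iter n (pseudo_shift Z wb phi_incr) x i =
  (orbit_weight n i)%:C * x (iter n phi i).
Proof.
elim: n i => [|n IHn] i; first by rewrite /orbit_weight big_ord0 mul1r.
rewrite iterS.
have -> y : pseudo_shift Z wb phi_incr y i = (w (phi i))%:C * y (phi i) by [].
rewrite IHn /orbit_weight big_ord_recl rmorphM mulrA -iterSr.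
by congr (_ * _%:C * _); apply: eq_bigr => j _; rewrite -iterSr.
Qed.

Lemma phi_gt i : (i < phi i)%N.
Proof. by elim: i => // i ih; apply: leq_ltn_trans ih (phi_incr _ _ _). Qed.

Lemma iter_phi_ge n i : (n + i <= iter n phi i)%N.
Proof. by elim: n => // n ih; apply: leq_ltn_trans ih (phi_gt _). Qed.

Lemma iter_phi_inj n : injective (iter n phi).
Proof.
elim: n => [//|n ih] i j /=.
have := @phi_incr (iter n phi i) (iter n phi j).
have := @phi_incr (iter n phi j) (iter n phi i).
case: (ltngtP (iter n phi i) (iter n phi j)) => [_ _|_|/ih//].
  by move=> /(_ isT) + e; rewrite e ltnn.
by move=> /(_ isT) + _ e; rewrite e ltnn.
Qed.

Lemma iter_phi_eq n m i a : (n <= m)%N ->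
  iter n phi i = iter m phi a -> i = iter (m - n) phi a.
Proof. by move=> nm; rewrite -{1}(subnKC nm) iterD => /iter_phi_inj. Qed.

(** * Approximating separated targets along one orbit *)

(** At time [m] the target is [u m], supported in [0, k m[.  Times with [k m = 0]
    are idle, and the gap condition only concerns the others. *)
Section separated_targets.
Variables (k : nat -> nat) (u : nat -> nat -> R[i]).
Hypothesis u_supp : forall m a, (k m <= a)%N -> u m a = 0.
Hypothesis k_gap : forall m n, (0 < k m)%N -> (0 < k n)%N -> (n < m)%N ->
  (maxn (k n) (k m) <= m - n)%N.

(** Two times [n < m] cannot prescribe the same coordinate: the index [b] used
    at time [n] would be at least [m - n >= k n]. *)
Lemma active_positions_inj :
  {in [set p | (p.2 < k p.1)%N] &, injective (fun p => iter p.1 phi p.2)}.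
Proof.
have later m n a b : (a < k m)%N -> (b < k n)%N -> (n < m)%N ->
    iter n phi b <> iter m phi a.
  move=> am bn nm /(iter_phi_eq _ _ _ _ (ltnW nm)) bE.
  have := @k_gap m n (leq_ltn_trans (leq0n _) am) (leq_ltn_trans (leq0n _) bn) nm.
  by have := iter_phi_ge (m - n) a; rewrite -bE; lia.
move=> [m a] [n b]; rewrite !inE/= => am bn e.
case: (ltngtP m n) => [mn|nm|mn].
- by case: (later n m b a).
- by case: (later m n a b).
- by subst n; rewrite (iter_phi_inj m _ _ e).
Qed.

(** For fixed [m] only finitely many pairs [(n, a)] occur, and they determine
    [i]; hence one constant [K m] controls all the coordinates that the target
    [u m] produces at time [m] and at the earlier times. *)
Lemma ex_size_bound : exists K : nat -> R, (forall m, 0 <= K m) /\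
  forall m a n i, (a < k m)%N ->
  (n <= m)%N -> iter n phi i = iter m phi a ->
  orbit_weight n i * (normc (u m a) / orbit_weight m a) <=
  K m * (m.+1%:R^-1 * 2^-1 ^+ i).
Proof.
pose t m (n a : nat) : R := let i := iter (m - n) phi a in
  orbit_weight n i * (normc (u m a) / orbit_weight m a) /
  (m.+1%:R^-1 * 2^-1 ^+ i).
have d0 m i : 0 < m.+1%:R^-1 * 2^-1 ^+ i :> R.
  by rewrite mulr_gt0 ?invr_gt0 ?half_exp_gt0.
have t0 m n a : 0 <= t m n a.
  by rewrite divr_ge0 ?(ltW (d0 _ _))// mulr_ge0 ?divr_ge0 ?normc_ge0//
    ltW ?orbit_weight_gt0.
exists (fun m => \sum_(n < m.+1) \sum_(a < k m) t m n a).
split=> [m|m a n i am nm /(iter_phi_eq _ _ _ _ nm) ->].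
  by apply: sumr_ge0 => n _; apply: sumr_ge0.
rewrite -ler_pdivrMr//.
rewrite (bigD1 (Ordinal (nm : (n < m.+1)%N)))//= (bigD1 (Ordinal am))//=.
by rewrite -addrA lerDl addr_ge0 ?sumr_ge0// => j _; exact: sumr_ge0.
Qed.

(** The coordinate [i] of T^n (l_n x) reads [x] at [iter n phi i].  If this
    position was prescribed at time [n] the error is zero, earlier times cannot
    reach it, and a later time [m] is damped by the size of [l m]. *)
Lemma simultaneous_approximation Z (Gamma : set R[i]) :
  ~ bounded_set (Gamma : set R[i]^o) ->
  exists (l : nat -> R[i]) (x : seq_space Z), (forall n, Gamma (l n)) /\
    forall n i, (0 < k n)%N ->
    normc (l n * ((orbit_weight n i)%:C * x (iter n phi i)) - u n i)
      <= (k n).+1%:R^-1 * 2^-1 ^+ i.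
Proof.
move=> unb; have [K [K0 KP]] := ex_size_bound.
have [l [lG l0 lK lrapid]] := rapid_sequence R Gamma K unb.
pose W := orbit_weight.
have W0 n i : 0 < W n i by exact: orbit_weight_gt0.
have nW n i : normc (W n i)%:C = W n i by rewrite normc_real gtr0_norm.
have WC0 n i : (W n i)%:C != 0.
  by apply/eqP => W_eq0; have := W0 n i; rewrite -nW W_eq0 normc0 ltxx.
have lC0 n : l n != 0.
  by apply/eqP => l_eq0; have := l0 n; rewrite l_eq0 normc0 ltxx.
have d0 m i : 0 < m.+1%:R^-1 * 2^-1 ^+ i :> R.
  by rewrite mulr_gt0 ?invr_gt0 ?half_exp_gt0.
pose v (p : nat * nat) := u p.1 p.2 / (l p.1 * (W p.1 p.2)%:C).
have nv m a : normc (v (m, a)) = (normc (u m a) / W m a) / normc (l m).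
  by rewrite /v normcM normcV normcM nW invfM /= mulrA mulrAC.
have [x [xE x_eq0]] := extension_by_zero _ _ _ _ _ v active_positions_inj.
have x_mem : x \in seq_pred Z.
  apply/seq_predP/(@seq_mem_le_geometric _ Z 1) => // j; rewrite mul1r.
  have [[[m a] [/= am <-]]|noj] := pselect (exists p : nat * nat,
      (p.2 < k p.1)%N /\ iter p.1 phi p.2 = j); last first.
    rewrite x_eq0 ?normc0 ?(ltW (half_exp_gt0 _ _))// => p pk pj.
    by apply: noj; exists p.
  rewrite (xE (m, a))// nv ler_pdivrMr//.
  (* Time 0 of the bound, where the orbit weight is 1, concerns x itself. *)
  have := KP m a 0%N _ am isT erefl.
  rewrite {1}/orbit_weight big_ord0 mul1r => /le_trans; apply.
  rewrite [leRHS]mulrC; apply: ler_pM; [exact: K0|exact: ltW| exact: lK|].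
  by rewrite ler_piMl ?(ltW (half_exp_gt0 _ _))// invf_le1// ler1n.
exists l, (SeqSpace x_mem); split=> // n i kn.
(* On the first k n coordinates the agreement is exact. *)
have [ik|ki] := ltnP i (k n).
  rewrite /= (xE (n, i))// /v/= mulrA -/(W n i) mulrCA mulfV ?mulr1 ?mulf_neq0//.
  by rewrite subrr normc0 ltW.
rewrite u_supp// subr0 /=.
have [[[m a] [/= am e]]|noj] := pselect (exists p : nat * nat,
    (p.2 < k p.1)%N /\ iter p.1 phi p.2 = iter n phi i); last first.
  rewrite x_eq0 ?mulr0 ?normc0 ?(ltW (d0 _ _))// => p pk pj.
  by apply: noj; exists p.
have km : (0 < k m)%N by exact: leq_ltn_trans am.
have [mn|nm|mn] := ltngtP m n.
- have := @k_gap n m kn km mn; have := iter_phi_ge (n - m) i.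
  by rewrite -(iter_phi_eq _ _ _ _ (ltnW mn) e); lia.
- rewrite -e (xE (m, a))// normcM normcM nW nv.
  rewrite [W n i * _]mulrA mulrA ler_pdivrMr//.
  have := KP m a n i am (ltnW nm) (esym e); rewrite -/(W n i) => KPmn.
  apply: (@le_trans _ _ (normc (l n) * (K m * (m.+1%:R^-1 * 2^-1 ^+ i)))).
    by rewrite ler_wpM2l// ltW.
  rewrite mulrA [_ * K m]mulrC [leRHS]mulrC.
  apply: ler_pM; [by rewrite mulr_ge0 ?normc_ge0|exact: ltW|exact: lrapid|].
  rewrite ler_wpM2r ?(ltW (half_exp_gt0 _ _))// lef_pV2 ?posrE// ler_nat ltnS.
  by have := @k_gap m n km kn nm; lia.
- by move: e; rewrite mn => /iter_phi_inj ai; move: am; rewrite ai mn ltnNge ki.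
Qed.

End separated_targets.
End pseudo_shift_orbits.

(** * Hypercyclicity *)

Lemma injective_unbounded (f : nat -> nat) : injective f ->
  forall N, exists n, (N <= f n)%N.
Proof.
move=> f_inj N; apply: contrapT => /forallNP small.
have fN (n : 'I_N.+1) : (f n < N)%N by rewrite ltnNge; apply/negP/small.
have g_inj : injective (fun n => Ordinal (fN n)).
  by move=> a b /(congr1 val)/= /f_inj /val_inj.
by have := leq_card _ g_inj; rewrite !card_ord ltnn.
Qed.

Theorem theorem4p2 (R : realType) (F : set (set nat)) (Gamma : set R[i])
    (F_hyp : hypercyclicity_set F)
    (Gamma_unbounded : ~ bounded_set (Gamma : set R[i]^o))
    (Z : space_kind R) (w : nat -> R) (phi : nat -> nat)
    (w_gt0 : forall n, 0 < w n) (w_bounded : bounded_fun w)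
    (phi_incr : {homo phi : m n / (m < n)%N}) (phi_gt0 : (0 < phi 0)%N) :
  hypercyclic F Gamma (pseudo_shift Z w_bounded phi_incr).
Proof.
case: F_hyp => -[_ _ F_up] [A [FA A_triv A_gap]].
(* Coding pairs (t, N) makes every list t occur as s k for infinitely many k. *)
pose s k : seq (rat * rat) :=
  if (unpickle k : option (seq (rat * rat) * nat)) is Some (t, _) then t else [::].
pose y k (i : nat) : R[i] := if (i < k)%N then rational_vector R (s k) i else 0.
(* The index of the set A k containing n, and 0 if there is none. *)
pose block n := xget 0%N [set k | (1 <= k)%N /\ A k n].
have blockP n : (0 < block n)%N -> A (block n) n.
  by rewrite /block; case: xgetP => // k _ [].
have blockE k n : (1 <= k)%N -> A k n -> block n = k.
  move=> k1 Akn.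
  have [block_gt0 Ablock] : [set k | (1 <= k)%N /\ A k n] (block n).
    by apply: (xgetI _ (x := k)).
  by apply: (A_triv _ _ block_gt0 k1); exists n.
have y_supp n i : (block n <= i)%N -> y (block n) i = 0.
  by rewrite /y ltnNge => ->.
have block_gap m n : (0 < block m)%N -> (0 < block n)%N -> (n < m)%N ->
    (maxn (block n) (block m) <= m - n)%N.
  move=> km kn nm.
  have := A_gap _ _ _ _ kn km (blockP _ kn) (blockP _ km).
  by lia.
have [l [x [lG xP]]] := simultaneous_approximation R w phi w_gt0 phi_incr
  phi_gt0 block (fun n => y (block n)) y_supp block_gap Z Gamma Gamma_unbounded.
exists x => U Uopen [z Uz].
have [e e0 ballU] : exists2 e : R, 0 < e &
    forall v : seq_space Z, seq_norm Z (z - v) < e -> U v.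
  have /nbhs_ballP[e /= e0 eU] := open_nbhs_nbhs (conj Uopen Uz).
  have eE : e = (complex.Re e)%:C by rewrite RRe_real// gtr0_real.
  exists (complex.Re e); first by rewrite -ltcR -eE.
  move=> v zv; apply: eU; rewrite -ball_normE /=.
  by rewrite seq_normE eE ltcR.
have e20 : 0 < e / 2 by rewrite divr_gt0.
have e40 : 0 < e / 2 / 2 by rewrite divr_gt0.
have [t tP] := rational_vector_dense R Z z _ e40.
have [B B0 boundB] := seq_norm_le_geometric R Z.
(* k >= size t makes y k the whole vector t, and k > B / (e / 2) makes the
   approximation error B / (k + 1) smaller than e / 2. *)
pose N0 := maxn (size t) (Num.trunc (B / (e / 2))).+1.
have [N kN] : exists N : nat, (N0 <= pickle (t, N))%N.
  by apply: injective_unbounded => a b /(pcan_inj pickleK)[].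
set k := pickle (t, N) in kN.
have sk : s k = t by rewrite /s pickleK.
have [tk Bk] : (size t <= k)%N /\ B / (e / 2) < k%:R.
  move: kN; rewrite geq_max => /andP[-> Bk]; split=> //.
  by apply: lt_le_trans (truncnS_gt _) _; rewrite ler_nat.
have k1 : (1 <= k)%N.
  by rewrite -(ltr_nat R); apply: le_lt_trans Bk; rewrite divr_ge0 ?ltW.
apply: (F_up (A k)); last exact: FA.
move=> n Akn.
have block_n := blockE k n k1 Akn.
exists (iter n (pseudo_shift Z w_bounded phi_incr) (l n *: x)); split.
  by exists (l n *: x) => //; exists (l n).
have y_mem : y k \in seq_pred Z.
  apply/seq_predP; apply: (@seq_mem_finite_support R Z k) => i.
  by rewrite /y ltnNge => ->.
pose v := SeqSpace y_mem.
apply: ballU; set Tx := iter _ _ _.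
have -> : z - Tx = (z - v) + (v - Tx) by rewrite addrA subrK.
apply: le_lt_trans (seq_normD _ _) _; rewrite (splitr e); apply: ltr_leD.
  apply: le_lt_trans (_ : e / 2 / 2 < e / 2); last first.
    by rewrite ltr_pdivrMr// ltr_pMr// ltr1n.
  apply: tP; apply/funext => i /=; rewrite /y sk; case: ltnP => // ki.
  by rewrite rational_vector_default// (leq_trans tk).
apply: le_trans (_ : k.+1%:R^-1 * B <= _).
  apply: boundB => // i.
  have -> : (v - Tx) i = v i - Tx i by [].
  rewrite -normcN opprB iter_pseudo_shift seq_spaceZ mulrCA /=.
  by have := xP n i; rewrite block_n => /(_ k1).
rewrite mulrC ler_pdivrMr// mulrC -ler_pdivrMr// ltW//.
by apply: lt_trans Bk _; rewrite ltr_nat.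
Qed.
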